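(* Let $E(z)=e^z$ and, for an integer $k>1$, let $E^k$ denote the $k$-times composition of $E$ with itself. Then for every non-constant polynomial $P$ with complex coefficients, the entire function $E^k(z)+P(z)$ has Baker omitted value (that is, $\infty$ is a Baker omitted value of it).
   Context: Write $\widehat{\mathbb{C}}=\mathbb{C}\cup\{\infty\}$. A point $a\in\widehat{\mathbb{C}}$ is an omitted value of an entire function $f:\mathbb{C}\to\widehat{\mathbb{C}}$ if $f(z)\neq a$ for all $z\in\mathbb{C}$ (so $\infty$ is an omitted value of every entire function). An omitted value $a\in\widehat{\mathbb{C}}$ of an entire function $f$ is called a Baker omitted value (bov) if there is a disk $D$ in $\widehat{\mathbb{C}}$ with center at $a$ such that each connected component of the boundary of $f^{-1}(D)=\{z\in\mathbb{C}: f(z)\in D\}$ is bounded. A disk centered at $\infty$ is a set of the form $\{z\in\mathbb{C}:|z|>R\}\cup\{\infty\}$ with $R>0$. Saying that an entire function ''has Baker omitted value'' means that $\infty$ is a Baker omitted value of it. *)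

(* Defs.v *)
From HB Require Import structures.
From mathcomp Require Import all_boot all_order all_algebra.
From mathcomp Require Import all_classical all_reals all_analysis.
From mathcomp Require Import complex.

Set Implicit Arguments.
Unset Strict Implicit.
Unset Printing Implicit Defensive.

Import Order.TTheory GRing.Theory Num.Theory.
Import numFieldNormedType.Exports.

Local Open Scope classical_set_scope.
Local Open Scope ring_scope.
Local Open Scope complex_scope.

(* R[i] is the complex plane over the reals R. Its topology and its structure
   of normed module over itself are found on the regular module R[i]^o, which
   is convertible to R[i]; the norm `|z| of z : R[i] is again an element of
   R[i], hence the embeddings r%:C of real radii below. *)
Notation plane R := (R[i]^o).

(* e^(x + iy) = e^x (cos y + i sin y) *)
Definition cexp (R : realType) (z : R[i]) : R[i] :=
  (expR (complex.Re z))%:C *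
    (cos (complex.Im z) +i* sin (complex.Im z)).

(* Since the direction 1 is scaled by increments in R[i], this is complex
   differentiability at every point. *)
Definition entire (R : realType) (f : plane R -> plane R) : Prop :=
  forall z : plane R, derivable f z 1.

(* None is the point at infinity. *)
Notation sphere R := (one_point_compactification (plane R)).

Definition sphere_disk (R : realType) (a : sphere R) (r : R) : set (sphere R) :=
  if a is Some c then [set Some z | z in [set z : plane R | `|z - c| < r%:C]]
  else [set Some z | z in [set z : plane R | r%:C < `|z|]] `|` [set None].

Definition omitted_value (R : realType) (f : plane R -> plane R)
    (a : sphere R) : Prop :=
  forall z : plane R, Some (f z) <> a.

Definition boundary (T : topologicalType) (A : set T) : set T :=
  closure A `\` A°.

Definition baker_omitted_value (R : realType) (f : plane R -> plane R)
    (a : sphere R) : Prop :=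
  [/\ entire f, omitted_value f a &
    exists2 r : R, 0 < r &
      let B := boundary [set z : plane R | sphere_disk a r (Some (f z))] in
      forall z : plane R, B z -> bounded_set (connected_component B z)].

Definition has_baker_omitted_value (R : realType)
    (f : plane R -> plane R) : Prop :=
  baker_omitted_value f None.

(* Main.v *)
Require Import Defs.
From mathcomp Require Import all_boot all_order all_algebra.
From mathcomp Require Import all_classical all_reals all_analysis.
From mathcomp Require Import complex.
From mathcomp Require Import ring lra.

(** Write f = E^k + P, w_j = E^j(z), and let C be a connected set on which
|f| <= r; the boundary of {|f| > r} lies in {|f| <= r}, so it is enough to show
that C is bounded.

On C one has |w_k| = |P(z)| + O(1), which is large where z is large.  Since
|E(w)| = exp(Re w), a large |w_k| makes Re w_(k-1) large, hence |w_(k-1)|, hence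
Re w_(k-2), and so on down to Re z ([Re_iter_cexp_ge]).  Two obstructions follow.

For j <= k-2 the number w_(j+1) = E(w_j) has positive real part, so the lines
Im w_j = pi modulo 2 pi do not meet C away from a disk.  As C is connected, Im w_j
cannot cross them outside of the disk, and therefore it is bounded on C
([connected_avoid_angle]).

In particular Im z is bounded on C while Re z is large, so that P(z) has nearly
the argument of its leading coefficient a ([Re_poly_half_strip]).  If Im w_(k-1)
were equal to arg a modulo 2 pi, then w_k = E(w_(k-1)) would be a positive
multiple of a, and w_k + P(z) would have a modulus larger than r.  So Im w_(k-1)
also avoids an angle modulo 2 pi, and it is bounded on C as well.  This is where
k > 1 is used: Im z has to be controlled before the last iterate is considered.

Finally |w_j| <= Re w_j + |Im w_j| <= |w_(j+1)| + O(1) for j <= k-2, whence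
|z| <= |w_(k-1)| + O(1) <= Re w_(k-1) + O(1), while
exp(Re w_(k-1)) = |w_k| <= |P(z)| + r grows at most like a power of |z|.  Hence |z|
is bounded on C ([connected_sublevel_bounded]).

The moduli are taken in R, by means of [normc], rather than in R[i], in order to
compare them with values of the real exponential. *)

Set Implicit Arguments.
Unset Strict Implicit.
Unset Printing Implicit Defensive.

Import Order.TTheory GRing.Theory Num.Theory.
Import numFieldNormedType.Exports.
Import ComplexField.Normc.

Local Open Scope classical_set_scope.
Local Open Scope ring_scope.
Local Open Scope complex_scope.

(** * Moduli and the exponential *)

Section Modulus.
Variable R : realType.
Implicit Types z w : R[i].

Lemma normCE z : `|z| = (normc z)%:C.
Proof. by []. Qed.

Lemma normc_real (x : R) : normc x%:C = `|x|.
Proof. by rewrite /normc /= expr0n/= addr0 sqrtr_sqr. Qed.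

Lemma normcX z n : normc (z ^+ n) = normc z ^+ n.
Proof. by elim: n => [|n IH]; rewrite ?expr0 ?normc1// !exprS normcM IH. Qed.

Lemma normc_ge0 z : 0 <= normc z.
Proof. by case: z => a b; exact: sqrtr_ge0. Qed.

Lemma normc_gt0 z : (0 < normc z) = (z != 0).
Proof. by rewrite -ltcR -normCE normr_gt0. Qed.

Lemma normc_i : normc ('i : R[i]) = 1.
Proof. by rewrite /= expr0n/= add0r expr1n sqrtr1. Qed.

Lemma Re_le_normc z : `|complex.Re z| <= normc z.
Proof. by have := normc_ge_Re z; rewrite normCE lecR. Qed.

Lemma Im_le_normc z : `|complex.Im z| <= normc z.
Proof. by case: z => a b /=; rewrite -sqrtr_sqr ler_wsqrtr // lerDr sqr_ge0. Qed.

Lemma normc_le_ReIm z : normc z <= `|complex.Re z| + `|complex.Im z|.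
Proof.
rewrite [z in leLHS]complexE (le_trans (le_normcD _ _))//.
by rewrite normcM !normc_real normc_i mul1r.
Qed.

Lemma le_normcB z w : normc z - normc w <= normc (z + w).
Proof. by rewrite lerBlDr -{1}(addrK w z) (le_trans (le_normcD _ _))// normcN. Qed.

Lemma normc_cexp z : normc (cexp z) = expR (complex.Re z).
Proof.
rewrite /cexp normcM normc_real ger0_norm ?expR_ge0//= cos2Dsin2 sqrtr1.
by rewrite mulr1.
Qed.

Lemma cexpD z w : cexp (z + w) = cexp z * cexp w.
Proof.
case: z w => [a b] [c d]; rewrite /cexp /= expRD cosD sinD.
rewrite mulrACA -rmorphM/=; congr (_ * _); simpc.
by congr (_ +i* _); rewrite addrC.
Qed.

End Modulus.

(** * Entire functions *)

Section Entire.
Variable R : realType.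

Lemma is_derive0_expansion (g : R -> R) (d e : R) :
  is_derive (0 : R) (1 : R) g d -> 0 < e ->
  exists2 del : R, 0 < del &
    forall h : R, `|h| < del -> `|g h - g 0 - d * h| <= e * `|h|.
Proof.
move=> [dg <-] e0.
have /cvgr_dist_le/(_ _ e0)[/= del del0 H] :
  (fun h => h^-1 *: ((g \o shift 0) (h *: 1) - g 0)) @ 0^' --> 'D_1 g 0 := dg.
exists del => // h hdel; have [->|h0] := eqVneq h 0.
  by rewrite subrr sub0r mulr0 oppr0 normr0 mulr0.
have := H h; rewrite /ball_ /= sub0r normrN => /(_ hdel h0).
rewrite addr0 [_%:A]mulr1 => H1.
rewrite -ler_pdivrMr ?normr_gt0// -normf_div; apply: le_trans H1.
rewrite -normrN le_eqVlt; apply/orP; left; apply/eqP; congr (`|_|).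
rewrite /GRing.scale/= -/('D_1 g 0); by field.
Qed.

(** Complex differentiability of the exponential at the origin, deduced from the
real derivatives of its three real ingredients: with h = a + i b,
e^h - 1 - h = (e^a - 1 - a) e^(ib) + (1 + a) (cos b - 1 + i (sin b - b)) + i a b. *)
Lemma cexp_expansion (e : R) : 0 < e -> exists2 del : R, 0 < del &
  forall h : R[i], normc h < del -> normc (cexp h - 1 - h) <= e * normc h.
Proof.
move=> e0.
(* The three real errors, the second and third multiplied by |1 + a| <= 2, and
   |a b| <= (e / 8) |h| add up to (6 e / 8) |h|. *)
have e8 : 0 < e / 8 by rewrite divr_gt0.
have [d1 d10 H1] := is_derive0_expansion (is_derive_expR 0) e8.
have [d2 d20 H2] := is_derive0_expansion (is_derive_cos 0) e8.
have [d3 d30 H3] := is_derive0_expansion (is_derive_sin 0) e8.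
exists (Num.min 1 (Num.min (e / 8) (Num.min d1 (Num.min d2 d3)))).
  by rewrite !lt_min ltr01 e8 d10 d20 d30.
move=> h; rewrite !lt_min => /and5P[h1 h8 hd1 hd2 hd3].
have := Re_le_normc h; have := Im_le_normc h; have := normc_ge0 h.
have -> : cexp h - 1 - h =
  (expR (complex.Re h) - 1 - complex.Re h)%:C *
    (cos (complex.Im h) +i* sin (complex.Im h))
  + (1 + complex.Re h)%:C * ((cos (complex.Im h) - 1)%:C +
      'i%C * (sin (complex.Im h) - complex.Im h)%:C)
  + 'i%C * (complex.Re h * complex.Im h)%:C.
  by case: (h) => a b; rewrite /cexp /=; simpc; congr (_ +i* _); ring.
move: (complex.Re h) (complex.Im h) (normc h) h1 h8 hd1 hd2 hd3.
move=> a b m h1 h8 hd1 hd2 hd3 m0 bm am.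
have := H1 a (le_lt_trans am hd1); rewrite expR0 mul1r => {}H1.
have := H2 b (le_lt_trans bm hd2); rewrite cos0 sin0 oppr0 mul0r subr0 => {}H2.
have := H3 b (le_lt_trans bm hd3); rewrite sin0 cos0 subr0 mul1r => {}H3.
have nu : normc (cos b +i* sin b) = 1 by rewrite /= cos2Dsin2 sqrtr1.
apply: le_trans (le_normcD _ _) _.
have T1 := le_normcD ((expR a - 1 - a)%:C * (cos b +i* sin b))
  ((1 + a)%:C * ((cos b - 1)%:C + 'i%C * (sin b - b)%:C)).
have T2 := le_normcD ((cos b - 1)%:C) ('i%C * (sin b - b)%:C).
move: T1 T2; rewrite !normcM normc_i nu !mul1r !mulr1 !normc_real normrM => T1 T2.
have Ha1 : `|1 + a| <= 2 by rewrite (le_trans (ler_normD _ _))// normr1; lra.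
have Hab : `|a| * `|b| <= e / 8 * m by apply: ler_pM => //; lra.
have Hn : normc ((cos b - 1)%:C + 'i%C * (sin b - b)%:C) <= e / 4 * m.
  apply: (le_trans T2); have : e / 8 * `|b| <= e / 8 * m by rewrite ler_wpM2l// ltW.
  lra.
have H4 := ler_pM (normr_ge0 _) (normc_ge0 _) Ha1 Hn.
have em0 := mulr_ge0 (ltW e0) m0.
have : e / 8 * `|a| <= e / 8 * m by rewrite ler_wpM2l// ltW.
move=> Ha; apply: le_trans (lerD T1 (lexx _)) _.
lra.
Qed.

Lemma entire_cexp : entire (@cexp R).
Proof.
move=> z; apply/cvg_ex; exists (cexp z : R[i]^o).
apply/cvgrPdist_le => eps; rewrite ltcE => /= /andP[/eqP e0 Re0].
have : 0 < complex.Re eps / expR (complex.Re z) by rewrite divr_gt0 ?expR_gt0.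
move=> /cexp_expansion[del del0 H].
exists del%:C; first by rewrite /= ltcR.
move=> h; rewrite /= sub0r normrN normCE ltcR => hdel h0.
have -> : eps = (complex.Re eps)%:C by rewrite [LHS]complexE e0 mulr0 addr0.
rewrite lecR /GRing.scale /= mulr1 cexpD.
have -> : cexp z - h^-1 * (cexp h * cexp z - cexp z) =
  cexp z * (- (h^-1 * (cexp h - 1 - h))) by field.
rewrite normcM normcN [normc (h^-1 * _)]normcM normcV normc_cexp.
have hh0 : 0 < normc h.
  by rewrite lt_def normc_ge0 andbT; apply: contra_neq h0 => /eq0_normc.
rewrite mulrC -ler_pdivlMr ?expR_gt0// mulrC ler_pdivrMr//.
exact: H.
Qed.

Lemma entire_comp (f g : plane R -> plane R) :
  entire f -> entire g -> entire (g \o f).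
Proof.
move=> ef eg z; apply/derivable1_diffP; apply: differentiable_comp;
exact/derivable1_diffP.
Qed.

Lemma entireD (f g : plane R -> plane R) :
  entire f -> entire g -> entire (fun z => f z + g z).
Proof. by move=> ef eg z; apply: derivableD. Qed.

Lemma entire_horner (p : {poly R[i]}) : entire (fun z : plane R => p.[z]).
Proof.
elim/poly_ind: p => [|p c IH].
  have -> : (fun z : plane R => (0 : {poly R[i]}).[z]) = cst 0.
    by apply/funext => z; rewrite horner0.
  by move=> z; exact: derivable_cst.
have -> : (fun z : plane R => (p * 'X + c%:P).[z]) = (fun z => p.[z] * z + c).
  by apply/funext => z; rewrite !hornerE.
apply: entireD => z; last exact: derivable_cst.
apply: derivableM; [exact: IH|exact: derivable_id].
Qed.

Lemma entire_iter_cexp k : entire (iter k (@cexp R)).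
Proof.
elim: k => [|k IH]; first by move=> z; exact: derivable_id.
exact: entire_comp IH entire_cexp.
Qed.

Lemma entire_continuous (f : plane R -> plane R) : entire f -> continuous f.
Proof. by move=> ef z; apply: differentiable_continuous; apply/derivable1_diffP. Qed.

Lemma continuous_normc : continuous (@normc R : plane R -> R).
Proof.
move=> z; apply/(@cvgrPdist_lt _ _ _ (nbhs (z : plane R))) => eps eps0.
exists eps%:C; first by rewrite /= ltcR.
move=> w; rewrite /= normCE ltcR; apply: le_lt_trans.
have := le_normcB z (w - z); have := le_normcB w (z - w).
rewrite ![_ + (_ - _)]addrC !subrK -(normcN (w - z)) opprB ler_norml.
lra.
Qed.

Lemma continuous_Im : continuous (@complex.Im R : plane R -> R).
Proof.
move=> z; apply/(@cvgrPdist_lt _ _ _ (nbhs (z : plane R))) => eps eps0.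
exists eps%:C; first by rewrite /= ltcR.
move=> w; rewrite /= normCE ltcR; apply: le_lt_trans.
by have := Im_le_normc (z - w); case: (z) (w) => [a b] [c d].
Qed.

End Entire.

(** * Growth of polynomials *)

Section PolynomialGrowth.
Variable R : realType.
Implicit Types (p : {poly R[i]}) (z u : R[i]).

(** The leading term may be taken at a point u near z.  With u = z this gives the
growth of |p|; with u = Re z it gives the argument of p in a horizontal strip.
The error is O(|u|^(n-1)); the factor [normc u] on the left avoids the negative
exponent when n = 0, the base case of the induction along Horner's scheme. *)
Lemma poly_lead_approx p n (Y : R) : 0 <= Y -> (size p <= n.+1)%N ->
  exists2 K : R, 0 <= K & forall z u, 1 <= normc u -> normc (z - u) <= Y ->
    normc u * normc (p.[z] - p`_n * u ^+ n) <= K * normc u ^+ n.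
Proof.
move=> Y0; elim: n p => [|n IH] p.
  move=> /size1_polyC ->; exists 0 => // z u _ _.
  by rewrite hornerC coefC/= !expr0 mulr1 subrr normc0 mulr0 mul0r.
elim/poly_ind: p => [_|q c _].
  exists 0 => // z u _ _.
  by rewrite horner0 coef0 mul0r subrr normc0 mulr0 mul0r.
move=> sz; have /IH[K K0 HK] : (size q <= n.+1)%N.
  by move: sz; rewrite size_MXaddC; case: ifP => // /andP[/eqP-> _]; rewrite size_poly0.
have a0 := normc_ge0 q`_n; have c0 := normc_ge0 c.
exists ((1 + Y) * K + normc q`_n * Y + normc c).
  by rewrite !addr_ge0// mulr_ge0// addr_ge0.
move=> z u u1 zu.
have u0 : 0 <= normc u := normc_ge0 u.
rewrite !hornerE coefD coefMX coefC/= addr0.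
have -> : q.[z] * z + c - q`_n * u ^+ n.+1 =
   (q.[z] - q`_n * u ^+ n) * z + q`_n * u ^+ n * (z - u) + c.
  by rewrite exprSr; ring.
have zle : normc z <= (1 + Y) * normc u.
  have := le_normcD (z - u) u; rewrite subrK => zle.
  have : Y <= Y * normc u by rewrite ler_peMr.
  lra.
have ule : normc u <= normc u ^+ n.+1 by rewrite exprS ler_peMr// exprn_ege1.
have T1 := le_normcD ((q.[z] - q`_n * u ^+ n) * z + q`_n * u ^+ n * (z - u)) c.
have T2 := le_normcD ((q.[z] - q`_n * u ^+ n) * z) (q`_n * u ^+ n * (z - u)).
rewrite !normcM normcX in T2.
have T3 : normc u * (normc (q.[z] - q`_n * u ^+ n) * normc z)
  <= (1 + Y) * K * normc u ^+ n.+1.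
  rewrite mulrA; apply: le_trans (_ : K * normc u ^+ n * ((1 + Y) * normc u) <= _).
    by apply: ler_pM => //; rewrite ?mulr_ge0 ?normc_ge0//; exact: HK.
  by rewrite exprSr le_eqVlt; apply/orP; left; apply/eqP; ring.
have T4 : normc u * (normc q`_n * normc u ^+ n * normc (z - u))
  <= normc q`_n * Y * normc u ^+ n.+1.
  have -> : normc u * (normc q`_n * normc u ^+ n * normc (z - u)) =
      normc q`_n * normc u ^+ n.+1 * normc (z - u) by rewrite exprS; ring.
  by rewrite [leRHS]mulrAC ler_wpM2l// mulr_ge0// exprn_ge0.
have T5 : normc u * normc c <= normc c * normc u ^+ n.+1.
  by rewrite mulrC ler_wpM2l.
have := ler_wpM2l u0 (le_trans T1 (lerD T2 (lexx _))).
move/le_trans; apply.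
by rewrite 2!mulrDr [leRHS]mulrDl [X in _ <= X + _]mulrDl !lerD.
Qed.

Lemma poly_upper_bound p n : (size p <= n.+1)%N ->
  exists2 K : R, 0 <= K & forall z, 1 <= normc z -> normc p.[z] <= K * normc z ^+ n.
Proof.
move=> /(poly_lead_approx (lexx 0))[K K0 HK].
exists (normc p`_n + K); first by rewrite addr_ge0 ?normc_ge0.
move=> z z1; have := HK z z z1; rewrite subrr normc0 => /(_ (lexx _)) H.
have := le_normcB p.[z] (- (p`_n * z ^+ n)); rewrite normcN normcM normcX.
have : normc (p.[z] - p`_n * z ^+ n) <= K * normc z ^+ n.
  by apply: le_trans H; rewrite ler_peMl ?normc_ge0.
lra.
Qed.

Lemma lead_coef_approx p n (Y : R) : 0 <= Y -> size p = n.+2 ->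
  exists K : R, forall z u, 1 <= normc u -> normc (z - u) <= Y ->
    normc (p.[z] / lead_coef p - u ^+ n.+1) <= K * normc u ^+ n.
Proof.
move=> Y0 sp; have [|K K0 HK] := @poly_lead_approx p n.+1 _ Y0; first by rewrite sp.
have a0 : 0 < normc (lead_coef p).
  by rewrite normc_gt0 lead_coef_eq0 -size_poly_eq0 sp.
have -> : lead_coef p = p`_n.+1 by rewrite lead_coefE sp.
move: a0; rewrite lead_coefE sp /= => a0.
exists (K / normc p`_n.+1) => z u u1 zu; have := HK z u u1 zu.
rewrite !exprS => H; rewrite [leRHS]mulrCA ler_pM2l ?(lt_le_trans ltr01)// in H.
have nz : p`_n.+1 != 0 by apply: contraTneq a0 => ->; rewrite normc0 ltxx.
have -> : p.[z] / p`_n.+1 - u * u ^+ n = (p.[z] - p`_n.+1 * (u * u ^+ n)) / p`_n.+1.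
  by field.
by rewrite normcM normcV mulrAC ler_wpM2r// invr_ge0 ltW.
Qed.

Lemma poly_tends_to_infinity p (T : R) : (1 < size p)%N ->
  exists M : R, forall z, M <= normc z -> T <= normc p.[z].
Proof.
case sp : (size p) => [|[|n]]// _.
have [K HK] := lead_coef_approx (lexx 0) sp.
have a0 : 0 < normc (lead_coef p).
  by rewrite normc_gt0 lead_coef_eq0 -size_poly_eq0 sp.
have [t <-] : exists t : R, t * normc (lead_coef p) = T.
  by exists (T / normc (lead_coef p)); rewrite divfK ?lt0r_neq0.
exists (1 + `|K| + `|t|) => z zM.
have nK := normr_ge0 K; have nt := normr_ge0 t.
have KK := ler_norm K; have tt := ler_norm t.
have z1 : 1 <= normc z by lra.
have := HK z z z1; rewrite subrr normc0 => /(_ (lexx _)) H.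
rewrite -ler_pdivlMr// -normcV -normcM.
have := le_normcB (z ^+ n.+1) (p.[z] / lead_coef p - z ^+ n.+1).
rewrite subrKC normcX exprS.
have : normc z - K <= (normc z - K) * normc z ^+ n.
  by rewrite ler_peMr ?exprn_ege1//; lra.
lra.
Qed.

(** In a half strip z is asymptotic to Re z, so the quotient of p by its leading
coefficient is asymptotic to a power of Re z, which is a positive number. *)
Lemma Re_poly_half_strip p (Y T : R) : (1 < size p)%N -> 0 <= Y ->
  exists X : R, forall z, X <= complex.Re z -> `|complex.Im z| <= Y ->
    T <= complex.Re (p.[z] / lead_coef p).
Proof.
case sp : (size p) => [|[|n]]// _ Y0.
have [K HK] := lead_coef_approx Y0 sp.
exists (1 + `|K| + `|T|) => z zX zY.
have nK := normr_ge0 K; have nT := normr_ge0 T.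
have KK := ler_norm K; have TT := ler_norm T.
have x1 : 1 <= complex.Re z by lra.
have nx : normc (complex.Re z)%:C = complex.Re z.
  by rewrite normc_real ger0_norm// (le_trans ler01).
have := HK z (complex.Re z)%:C; rewrite nx => /(_ x1).
rewrite [z in z - _]complexE addrC addKr normcM normc_real.
rewrite normc_i mul1r -rmorphXn/= => /(_ zY) H.
have := Re_le_normc (p.[z] / lead_coef p - (complex.Re z ^+ n.+1)%:C).
rewrite raddfB/= exprS => H2.
have : complex.Re z - K <= (complex.Re z - K) * complex.Re z ^+ n.
  by rewrite ler_peMr ?exprn_ege1//; lra.
move: H2; rewrite ler_norml => /andP[H2 _].
move: H; rewrite exprS mulrBl; lra.
Qed.

End PolynomialGrowth.

(** * Connected sets and avoided angles *)

Section Trap.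
Variable R : realType.

Lemma cos_sinDn2pi (t : R) n :
  cos (t + (pi *+ 2) *+ n) = cos t /\ sin (t + (pi *+ 2) *+ n) = sin t.
Proof.
elim: n => [|n [c s]]; first by rewrite mulr0n addr0.
by rewrite mulrSr addrA cosD2pi sinD2pi.
Qed.

Lemma connected_IVT (T : topologicalType) (C : set T) (g : T -> R) (L : R) x y :
  connected C -> continuous g -> C x -> C y -> g x <= L <= g y ->
  exists2 c, C c & g c = L.
Proof.
move=> cC cg Cx Cy xy.
have /connected_intervalP itv : connected (g @` C).
  by apply: connected_continuous_connected => //; exact: continuous_subspaceT.
have [c Cc gc] : (g @` C) L by exact: (itv (g x) (g y)).
by exists c.
Qed.

(** A continuous function that takes no value congruent to t modulo 2 pi on a
connected set is confined between two consecutive such values.  If this is known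
only outside of a disk on which g is bounded by b, the values t + 2 n pi and
t - 2 n pi with n large compared to b still cannot be taken, and serve as
barriers. *)
Lemma connected_avoid_angle (C : set (plane R)) (g : plane R -> R) (t M b : R) :
  connected C -> continuous g ->
  (forall z, C z -> M < normc z -> ~ (cos (g z) = cos t /\ sin (g z) = sin t)) ->
  (forall z, normc z <= M -> `|g z| <= b) ->
  exists Y : R, forall z, C z -> `|g z| <= Y.
Proof.
move=> cC cg avoid gb.
have [->|/set0P[z0 Cz0]] := eqVneq C set0; first by exists 0.
(* The starting value g z0 must lie between the two barriers as well. *)
pose n := Num.bound (`|t| + `|b| + `|g z0|).
have nP : `|t| + `|b| + `|g z0| < n%:R by apply: archi_boundP; rewrite !addr_ge0.
have nL : n%:R <= (pi : R) *+ 2 *+ n.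
  rewrite -[leRHS]mulr_natr ler_peMl//.
  by have := pi_ge2 R; rewrite mulr2n; lra.
pose W := (pi : R) *+ 2 *+ n.
have bad z : C z -> `|b| < `|g z| -> ~ (cos (g z) = cos t /\ sin (g z) = sin t).
  move=> Cz bz; apply: avoid => //; rewrite ltNge; apply/negP => /gb gzb.
  by have := ler_norm b; lra.
have tn := ler_norm t; have tn' := ler_norm (- t); rewrite normrN in tn'.
have b0 := normr_ge0 b; have g0 := normr_ge0 (g z0).
have gn := ler_norm (g z0); have gn' := ler_norm (- g z0); rewrite normrN in gn'.
rewrite -/W in nL.
exists (`|t| + W) => z Cz; rewrite leNgt; apply/negP; rewrite lter_normr => /orP[zW|zW].
- have [|c Cc cL] := connected_IVT (L := t + W) cC cg Cz0 Cz; first by lra.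
  apply: (bad c) => //; rewrite cL; last exact: cos_sinDn2pi.
  by rewrite [`|t + W|]ger0_norm; lra.
- have [|c Cc cL] := connected_IVT (L := t - W) cC cg Cz Cz0; first by lra.
  apply: (bad c) => //; rewrite cL.
    by rewrite [`|t - W|]ler0_norm; lra.
  by have [c1 s1] := cos_sinDn2pi (t - W) n; rewrite -/W subrK in c1 s1.
Qed.

Lemma unit_vector_angle (a b : R) : a ^+ 2 + b ^+ 2 = 1 ->
  exists t, cos t = a /\ sin t = b.
Proof.
move=> ab; have a1 : -1 <= a <= 1.
  have b0 := sqr_ge0 b; rewrite -ler_norml -(@expr_le1 _ 2)// real_normK ?num_real//; lra.
have ca : cos (acos a) = a by rewrite acosK// in_itv.
have sa : sin (acos a) = `|b|.
  by rewrite sin_acos// -sqrtr_sqr; congr Num.sqrt; lra.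
have [b0|b0] := leP 0 b; first by exists (acos a); rewrite sa ger0_norm.
by exists (- acos a); rewrite cosN sinN sa ltr0_norm// opprK.
Qed.

End Trap.

(** * Iterated exponentials *)

Section Iterates.
Variable R : realType.

Lemma expR_gt_id (x : R) : x < expR x.
Proof. by have := expR_ge1Dx x; lra. Qed.

Lemma iter_expR_le (T : R) m n : (m <= n)%N -> iter m expR T <= iter n expR T.
Proof.
move=> /subnK <-; elim: (n - m)%N => // d IH.
by rewrite addSn iterS (le_trans IH)// ltW ?expR_gt_id.
Qed.

(** Since |E(w)| = exp(Re w) and Re w <= |w|, a large iterate can only come from
large iterates before it, all of them with a large real part. *)
Lemma Re_ge_of_iter_cexp (T : R) m (w : R[i]) :
  iter m.+1 expR T <= normc (iter m.+1 (@cexp R) w) -> T <= complex.Re w.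
Proof.
elim: m => [|m IH]; first by rewrite !iterS normc_cexp ler_expR.
rewrite !(iterS m.+1) normc_cexp ler_expR => H.
by apply/IH/(le_trans H)/(le_trans (ler_norm _)); exact: Re_le_normc.
Qed.

Lemma normc_iter_cexp_le (M : R) j (z : R[i]) :
  normc z <= M -> normc (iter j (@cexp R) z) <= iter j expR M.
Proof.
move=> zM; elim: j => // j IH; rewrite !iterS normc_cexp ler_expR.
exact: le_trans (le_trans (ler_norm _) (Re_le_normc _)) IH.
Qed.

Lemma expR_beats_power (K D : R) n :
  exists X : R, forall t, 0 < t -> expR (t - D) <= K * t ^+ n -> t <= X.
Proof.
exists (K * expR D * n.+1`!%:R) => t t0 H.
have F : (0 : R) < n.+1`!%:R by rewrite ltr0n fact_gt0.
rewrite -ler_pdivrMr// -(ler_pM2r (exprn_gt0 n t0)) mulrAC -exprS.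
have := expR_ge1Dxn n (ltW t0).
rewrite -{2}(subrK D t) expRD -mulrA [expR D * _]mulrC mulrA.
by have := ler_wpM2r (expR_ge0 D) H; lra.
Qed.

End Iterates.

(** * Connected subsets of a sublevel set *)

Section Components.
Variables (R : realType) (m : nat) (P : {poly R[i]}) (r : R) (C : set (plane R)).
Hypotheses (sP : (1 < size P)%N) (cC : connected C).
Hypothesis Cr : forall z, C z -> normc (iter m.+2 (@cexp R) z + P.[z]) <= r.

Local Notation E j z := (iter j (@cexp R) z).

(** On C the polynomial, large far from the origin, has to be cancelled by the
last iterate, which is thus large too. *)
Lemma Re_iter_cexp_ge (T : R) : exists M : R, forall z, C z -> M <= normc z ->
  forall j, (j <= m.+1)%N -> T <= complex.Re (E j z).
Proof.
have [M HM] := poly_tends_to_infinity (iter m.+2 expR T + r) sP.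
exists M => z Cz /HM zM j jm; apply: (@Re_ge_of_iter_cexp _ _ (m.+1 - j)%N).
have T1 : iter (m.+1 - j).+1 expR T <= iter m.+2 expR T.
  by apply: iter_expR_le; rewrite ltnS leq_subr.
rewrite -iterD addSn subnK//; have := Cr Cz.
have := le_normcB P.[z] (E m.+2 z); rewrite [P.[z] + _]addrC; lra.
Qed.

Lemma continuous_Im_iter_cexp j : continuous (fun z : plane R => complex.Im (E j z)).
Proof.
move=> z; apply: (@continuous_comp _ _ _ (iter j (@cexp R) : plane R -> plane R));
  last exact: continuous_Im.
exact/entire_continuous/entire_iter_cexp.
Qed.

Lemma Im_iter_cexp_le_ball (M : R) j (z : R[i]) : normc z <= M ->
  `|complex.Im (E j z)| <= iter j expR M.
Proof. by move=> /(normc_iter_cexp_le j); apply/le_trans/Im_le_normc. Qed.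

(** The avoided angle is pi: if Im w_j were congruent to pi, then
w_(j+1) = E(w_j) would be a negative number. *)
Lemma Im_iter_cexp_bounded j : (j <= m)%N ->
  exists Y : R, forall z, C z -> `|complex.Im (E j z)| <= Y.
Proof.
move=> jm; have [M HM] := Re_iter_cexp_ge 1.
apply: (connected_avoid_angle (t := pi) (M := M) cC (@continuous_Im_iter_cexp j));
  last by move=> z; exact: Im_iter_cexp_le_ball.
move=> z Cz /ltW/(HM _ Cz) /(_ j.+1 jm); rewrite iterS => Re1 [c _].
move: Re1; rewrite /cexp /= mul0r subr0 c cospi.
have := expR_gt0 (complex.Re (E j z)); lra.
Qed.

(** The avoided angle is the argument of the leading coefficient a of P.  At such
an angle w_k / a > 0, and P(z) / a has a real part larger than r / |a| in the half
strip where z lies, so |w_k + P(z)| > r. *)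
Lemma Im_last_iter_cexp_bounded :
  exists Y : R, forall z, C z -> `|complex.Im (E m.+1 z)| <= Y.
Proof.
(* The case j = 0: C lies in a horizontal strip. *)
have [Y0 HY0] := Im_iter_cexp_bounded (leq0n m).
have a0 : lead_coef P != 0.
  by rewrite lead_coef_eq0 -size_poly_gt0 (ltn_trans _ sP).
pose na := normc (lead_coef P).
have na0 : 0 < na by rewrite normc_gt0.
have [|t [ct st]] := @unit_vector_angle _ (complex.Re (lead_coef P) / na)
    (complex.Im (lead_coef P) / na).
  have na2 : complex.Re (lead_coef P) ^+ 2 + complex.Im (lead_coef P) ^+ 2 = na ^+ 2.
    by rewrite /na; case: lead_coef => a b /=; rewrite sqr_sqrtr ?addr_ge0 ?sqr_ge0.
  by rewrite !exprMn -mulrDl exprVn na2 divff// expf_neq0// lt0r_neq0.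
have [X HX] := Re_poly_half_strip (r / na) sP (normr_ge0 Y0).
have [M HM] := Re_iter_cexp_ge X.
apply: (connected_avoid_angle (t := t) (M := M) cC (@continuous_Im_iter_cexp m.+1));
  last by move=> z; exact: Im_iter_cexp_le_ball.
move=> z Cz /ltW/(HM _ Cz) /(_ 0%N (leq0n _)) Xz; rewrite ct st => -[c s].
have HP := HX z Xz (le_trans (HY0 z Cz) (ler_norm _)).
have EE : E m.+2 z / lead_coef P = (expR (complex.Re (E m.+1 z)) / na)%:C.
  have -> : E m.+2 z = (expR (complex.Re (E m.+1 z)) / na)%:C * lead_coef P.
    rewrite iterS {1}/cexp c s; case: (lead_coef P) => a b /=; simpc.
    by congr (_ +i* _); ring.
  by rewrite mulfK.
have := Re_le_normc ((E m.+2 z + P.[z]) / lead_coef P).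
rewrite normcM normcV -/na mulrDl EE raddfD/=.
have : normc (E m.+2 z + P.[z]) / na <= r / na by rewrite ler_pM2r ?invr_gt0 ?Cr.
have : 0 < expR (complex.Re (E m.+1 z)) / na by rewrite divr_gt0 ?expR_gt0.
rewrite ler_norml => ? ? /andP[_ ?].
lra.
Qed.

(** Going from one iterate to the next loses only the bound on |Im w_j|, because
|w_j| <= Re w_j + |Im w_j| and Re w_j <= exp(Re w_j) = |w_(j+1)|. *)
Lemma normc_le_iter_cexp : exists M : R, forall j, (j <= m.+1)%N -> exists D : R,
  forall z, C z -> M <= normc z -> normc z <= normc (E j z) + D.
Proof.
have [M HM] := Re_iter_cexp_ge 0; exists M; elim=> [|j IH] jm.
  by exists 0 => z _ _; rewrite addr0.
have [D HD] := IH (ltnW jm).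
have [Y HY] := Im_iter_cexp_bounded jm.
exists (Y + D) => z Cz zM; apply: le_trans (HD z Cz zM) _.
rewrite addrA lerD2r; apply: le_trans (normc_le_ReIm _) _.
rewrite lerD ?HY// ger0_norm ?HM// 1?ltnW// iterS normc_cexp.
exact/ltW/expR_gt_id.
Qed.

Lemma connected_sublevel_bounded : exists Y : R, forall z, C z -> normc z <= Y.
Proof.
have [M1 HM1] := Re_iter_cexp_ge 0.
have [M2 /(_ _ (leqnn _))[D HD]] := normc_le_iter_cexp.
have [Y HY] := Im_last_iter_cexp_bounded.
have [|K K0 HK] := @poly_upper_bound _ P (size P) _; first exact: leqnSn.
have [X HX] := expR_beats_power (K + `|r|) (Y + D) (size P).
exists (Num.max 1 (Num.max M1 (Num.max M2 X))) => z Cz; rewrite !le_max.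
have [//|z1] := leP (normc z) 1; have [//|zM1] := leP (normc z) M1.
have [//|zM2] := leP (normc z) M2; rewrite /=; apply: HX; first by lra.
have Re0 := HM1 z Cz (ltW zM1) _ (leqnn _).
have H1 := HD z Cz (ltW zM2).
have H2 := normc_le_ReIm (E m.+1 z); rewrite (ger0_norm Re0) in H2.
have H3 := HY z Cz.
have H4 : expR (normc z - (Y + D)) <= normc (E m.+2 z).
  by rewrite iterS normc_cexp ler_expR; lra.
have H5 := le_normcB (E m.+2 z) P.[z].
have H6 := Cr Cz; have H7 := HK z (ltW z1).
have H8 : `|r| <= `|r| * normc z ^+ size P by rewrite ler_peMr// exprn_ege1// ltW.
have := ler_norm r; lra.
Qed.

End Components.

Theorem theorem1p2 (R : realType) (k : nat) (P : {poly R[i]}) :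
  (1 < k)%N -> (1 < size P)%N ->
  has_baker_omitted_value (fun z => iter k (@cexp R) z + P.[z]).
Proof.
case: k => [|[|m]]// _ sP.
set f : plane R -> plane R := fun z => _.
have ef : entire f by apply: entireD; [exact: entire_iter_cexp|exact: entire_horner].
split=> //; exists 1 => // B z0 _.
(* The set is open, so its boundary is disjoint from it. *)
have openA : open [set z : plane R | sphere_disk None 1 (Some (f z))].
  have -> : [set z : plane R | sphere_disk None 1 (Some (f z))] =
      (@normc R \o f) @^-1` [set x | 1 < x].
    apply/seteqP; split => z /=; rewrite -ltcR -normCE.
      by case=> // -[w fw [<-]].
    by move=> fz; left; exists (f z).
  apply: open_comp; last exact: open_gt.
  move=> z _; apply: (@continuous_comp _ _ _ f (@normc R)).
    exact: entire_continuous.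
  exact: continuous_normc.
have Br z : B z -> normc (f z) <= 1.
  move=> [_]; rewrite (proj1 (interior_id _) openA) => notA.
  rewrite leNgt; apply/negP => fz; apply: notA; left; exists (f z) => //=.
  by rewrite normCE ltcR.
have [|Y HY] := @connected_sublevel_bounded _ m P 1 _ sP (@component_connected _ B z0).
  by move=> z /connected_component_sub; exact: Br.
exists Y%:C; split; first by apply/complex_realP; exists Y.
move=> x Yx z Cz; apply: ltW; apply: le_lt_trans Yx.
by rewrite normCE lecR; exact: HY.
Qed.
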